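(* The analytic and geometric multiplicities of each eigenvalue of a self-adjoint discrete Sturm-Liouville problem, consisting of an equation $-\nabla(f_n\Delta y_n)+q_ny_n=\lambda w_ny_n$, $1\le n\le N$, and a boundary condition $A\begin{pmatrix}y_0\\ f_0\Delta y_0\end{pmatrix}+B\begin{pmatrix}y_N\\ f_N\Delta y_N\end{pmatrix}=0$, are the same.
   Context: $N\ge2$ is an integer, $\Delta y_n=y_{n+1}-y_n$, $\nabla y_n=y_n-y_{n-1}$; $A,B$ are complex $2\times2$ matrices with $\mathrm{rank}(A,B)=2$. The problem is self-adjoint if $f_0,\dots,f_N$, $q_1,\dots,q_N$, $w_1,\dots,w_N$ are real with all $f_n\neq0$ and all $w_n>0$, and $AEA^*=BEB^*$, where $E=\begin{pmatrix}0&1\\-1&0\end{pmatrix}$ and $A^*$ is the conjugate transpose of $A$. A complex number $\lambda$ is an eigenvalue of the problem if there is a nonzero sequence $y=\{y_n\}_{n=0}^{N+1}$ of complex numbers (an eigenfunction) satisfying both the equation and the boundary condition. The geometric multiplicity of $\lambda$ is the dimension of the space spanned by its eigenfunctions. $\phi(\lambda),\psi(\lambda)$ are the solutions of the equation (sequences indexed by $0\le n\le N+1$) with $\phi_0=1$, $f_0\Delta\phi_0=0$, $\psi_0=0$, $f_0\Delta\psi_0=1$, and $\Phi_n(\lambda)=\begin{pmatrix}\phi_n(\lambda)&\psi_n(\lambda)\\ f_n\Delta\phi_n(\lambda)&f_n\Delta\psi_n(\lambda)\end{pmatrix}$. The characteristic function is the polynomial $\Gamma(\lambda)=\det(A+B\Phi_N(\lambda))$,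 and the analytic multiplicity of an eigenvalue is its order as a zero of $\Gamma$. *)

(* Defs.v *)
From mathcomp Require Import all_boot all_order all_algebra.
From mathcomp Require Import reals complex.

Set Implicit Arguments.
Unset Strict Implicit.
Unset Printing Implicit Defensive.

Import GRing.Theory Num.Theory.
Local Open Scope ring_scope.
Local Open Scope sesquilinear_scope.

Section Differences.
Context {V : zmodType}.
Implicit Type y : nat -> V.

Definition fwd_diff y (n : nat) : V := y n.+1 - y n.

(* Only meaningful for n >= 1. *)
Definition bwd_diff y (n : nat) : V := y n - y n.-1.

End Differences.

Definition mx2 (T : nzRingType) (a b c d : T) : 'M[T]_2 :=
  \matrix_(i < 2, j < 2)
    if i == 0 then (if j == 0 then a else b) else (if j == 0 then c else d).

Definition Emx (T : nzRingType) : 'M[T]_2 := mx2 0 1 (-1) 0.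

Section SturmLiouville.
Context {R : realType}.
Local Notation C := R[i].

(* The coefficients f_0, ..., f_N, q_1, ..., q_N, w_1, ..., w_N are given by
   functions on nat; no definition below depends on their other values, except
   through the values of [sol] beyond the index N + 1. *)
Variables (N : nat) (f q w : nat -> C) (A B : 'M[C]_2).

Definition self_adjoint : Prop :=
  [/\ forall n, (n <= N)%N -> f n \is Num.real /\ f n != 0,
      forall n, (1 <= n <= N)%N -> q n \is Num.real,
      forall n, (1 <= n <= N)%N -> w n \is Num.real /\ 0 < w n
    & A *m Emx C *m A ^t* = B *m Emx C *m B ^t*].

Definition sl_equation (lam : C) (y : nat -> C) : Prop :=
  forall n, (1 <= n <= N)%N ->
    - bwd_diff (fun m => f m * fwd_diff y m) n + q n * y n = lam * w n * y n.

Definition state (y : nat -> C) (n : nat) : 'cV[C]_2 :=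
  \col_(i < 2) if i == 0 then y n else f n * fwd_diff y n.

Definition boundary_condition (y : nat -> C) : Prop :=
  A *m state y 0 + B *m state y N = 0.

(* A sequence y_0, ..., y_{N+1} is a vector of 'cV[C]_N.+2; [term y n] is y_n
   for n <= N + 1. *)
Definition term (y : 'cV[C]_N.+2) (n : nat) : C := y (inord n) 0.

Definition eigenfunction (lam : C) (y : 'cV[C]_N.+2) : Prop :=
  [/\ y != 0, sl_equation lam (term y) & boundary_condition (term y)].

Definition sl_eigenvalue (lam : C) : Prop := exists y, eigenfunction lam y.

Definition is_span (S : 'cV[C]_N.+2 -> Prop) (V : {vspace 'cV[C]_N.+2}) : Prop :=
  (forall y, S y -> y \in V) /\
  (forall W : {vspace 'cV[C]_N.+2}, (forall y, S y -> y \in W) -> (V <= W)%VS).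

Definition geometric_multiplicity (lam : C) (k : nat) : Prop :=
  exists2 V, is_span (eigenfunction lam) V & \dim V = k.

(* The pair (y_n, f_n Delta y_n) for the solution y with y_0 = a and
   f_0 Delta y_0 = b: the equation at n reads
   f_n Delta y_n = f_{n-1} Delta y_{n-1} + (q_n - lam w_n) y_n. *)
Fixpoint sol_state (lam a b : C) (n : nat) : C * C :=
  if n is m.+1 then
    let: (u, v) := sol_state lam a b m in
    let u' := u + v / f m in
    (u', v + (q n - lam * w n) * u')
  else (a, b).

Definition sol (lam a b : C) (n : nat) : C := (sol_state lam a b n).1.

Definition phi (lam : C) : nat -> C := sol lam 1 0.
Definition psi (lam : C) : nat -> C := sol lam 0 1.

Definition Phi (n : nat) (lam : C) : 'M[C]_2 :=
  mx2 (phi lam n) (psi lam n)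
      (f n * fwd_diff (phi lam) n) (f n * fwd_diff (psi lam) n).

Definition Gamma (lam : C) : C := \det (A + B *m Phi N lam).

(* The polynomial p is unique; p != 0 is needed for [mup] to be the order of a
   zero. *)
Definition analytic_multiplicity (lam : C) (k : nat) : Prop :=
  exists p : {poly C},
    [/\ forall z, p.[z] = Gamma z, p != 0 & mup lam p = k].

(* [sol lam a b] is the solution of the initial value problem. *)
Section InitialValueProblem.
Hypothesis f_neq0 : forall n, (n <= N)%N -> f n != 0.

Lemma sol_fdiff lam a b n : (n <= N)%N ->
  f n * fwd_diff (sol lam a b) n = (sol_state lam a b n).2.
Proof.
move=> leN; rewrite /fwd_diff /sol /=; case: (sol_state _ _ _ n) => u v /=.
by rewrite addrC addKr mulrC divfK // f_neq0.
Qed.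

Lemma sol_init lam a b :
  sol lam a b 0 = a /\ f 0 * fwd_diff (sol lam a b) 0 = b.
Proof. by rewrite sol_fdiff. Qed.

Lemma sol_equation lam a b : sl_equation lam (sol lam a b).
Proof.
move=> [//|n] /andP[_ leN]; rewrite /bwd_diff succnK !sol_fdiff ?(ltnW leN) //.
rewrite /sol /=; case: (sol_state _ _ _ n) => u v /=.
by rewrite addrAC subrr add0r mulrBl opprB subrK.
Qed.

Lemma sol_unique lam a b (y : nat -> C) :
    sl_equation lam y -> y 0%N = a -> f 0 * fwd_diff y 0 = b ->
  forall n, (n <= N.+1)%N -> y n = sol lam a b n.
Proof.
move=> eqy ya yb.
have step n : (n <= N)%N ->
    y n = sol lam a b n /\ f n * fwd_diff y n = f n * fwd_diff (sol lam a b) n.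
  elim: n => [|n IHn] leN; first by have [-> ->] := sol_init lam a b.
  have [yn dyn] := IHn (ltnW leN).
  have yn1 : y n.+1 = sol lam a b n.+1.
    move/(mulfI (f_neq0 (ltnW leN))): dyn.
    by rewrite /fwd_diff yn => /addIr.
  split=> //; have Hy := eqy n.+1 leN; have Hs := @sol_equation lam a b n.+1 leN.
  move: Hy; rewrite yn1 -Hs => /addIr /oppr_inj.
  by rewrite /bwd_diff succnK dyn => /addIr.
case=> [_|n]; first by rewrite ya.
rewrite ltnS => leN; have [yn /(mulfI (f_neq0 leN))] := step n leN.
by rewrite /fwd_diff yn => /addIr.
Qed.

End InitialValueProblem.

End SturmLiouville.

(* Main.v *)
Require Import Defs.
From mathcomp Require Import all_boot all_order all_algebra.
From mathcomp Require Import reals complex ring.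
Set Implicit Arguments.
Unset Strict Implicit.
Unset Printing Implicit Defensive.
Import Order.TTheory GRing.Theory Num.Theory.
Local Open Scope ring_scope.
Local Open Scope sesquilinear_scope.

(** Write T(z) for the fundamental matrix Phi_N(z) and M(z) = A + B T(z), so
    that Gamma(z) is the determinant of M(z). A solution of the equation is
    determined by its initial data v, and it satisfies the boundary condition
    if and only if M(z) v = 0. Hence the geometric multiplicity of l is the
    dimension 2 - rank M(l) of the kernel of M(l)
    ([geometric_multiplicity_corank]), and the claim is that Gamma vanishes at
    l to this order.

    The determinant of a pencil M(l) + (z - l) D(z) vanishes at l to order at
    least the corank of M(l), with equality as soon as D(l) maps no nonzero
    vector of the kernel of M(l) into the image of M(l)
    ([mup_det_transversal]).

    For the self-adjoint problem both ingredients come from the Lagrange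
    identity T(mu)^* E T(z) = E + (mu^* - z) P(mu, z), where P(mu, z) is the sum
    of w_n r_n(mu)^* r_n(z) over n = 1, ..., N and r_n is the first row of Phi_n
    ([lagrange_identity]). The form P(z, z) is positive definite
    ([weight_form_definite]). Given a right null vector v of M(l), the relation
    A E A^* = B E B^* provides a row u with u B = - v^* T(l)^* E and
    u M(l) = (l - l^* ) v^* P(l, l) ([char_mx_null]). Multiplying by v shows
    that l is real ([eigenvalue_real]), and then u M(l) = 0. For real l the identity
    also gives T(z) = T(l) + (z - l) T(l) E P(l, z), thus the required expansion
    with D(z) = B T(l) E P(l, z). If D(l) v = M(l) x, then
    0 = u M(l) x = u D(l) v = v^* P(l, l) v, so v = 0
    ([char_mx_transversal]). *)

(** * Order of vanishing of the determinant of a matrix pencil *)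

Section Determinant.
Variable F : fieldType.

Definition evalmx (a : F) m n (D : 'M[{poly F}]_(m, n)) : 'M[F]_(m, n) :=
  map_mx (horner_eval a) D.

Lemma evalmx_polyC a m n (M : 'M[F]_(m, n)) : evalmx a (map_mx polyC M) = M.
Proof. by apply/matrixP=> i j; rewrite !mxE /horner_eval hornerC. Qed.

Lemma evalmxM a m n k (X : 'M[{poly F}]_(m, n)) (Y : 'M_(n, k)) :
  evalmx a (X *m Y) = evalmx a X *m evalmx a Y.
Proof. exact: map_mxM. Qed.

Lemma mulmx_inj_unitmx n (M : 'M[F]_n) :
  (forall v : 'cV_n, M *m v = 0 -> v = 0) -> M \in unitmx.
Proof.
move=> Minj; rewrite -unitmx_tr -row_free_unit -kermx_eq0.
apply/eqP/row_matrixP=> i; rewrite row0; apply: trmx_inj; rewrite trmx0.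
apply: Minj; apply: trmx_inj; rewrite trmx_mul trmxK trmx0.
by apply/sub_kermxP; rewrite row_sub.
Qed.

Lemma det_evalmx a n (D : 'M[{poly F}]_n) : \det (evalmx a D) = (\det D).[a].
Proof. by rewrite /evalmx det_map_mx. Qed.

Lemma prod_ord_geq n r (t : {poly F}) : (r <= n)%N ->
  \prod_(i < n) (if (i < r)%N then 1 else t) = t ^+ (n - r).
Proof.
move=> rn; rewrite -(big_mkord xpredT (fun i => if (i < r)%N then 1 else t)).
rewrite (big_cat_nat _ rn) //= big_nat big1 ?mul1r => [|i /andP[_ ->] //].
by rewrite -prodr_const_nat; apply: eq_big_nat => i /andP[ri _];
   rewrite ltnNge ri.
Qed.

(** Choose bases in which M is the partial identity of rank r. In
    pid_mx r + ('X - a) *: D the last n - r rows are divisible by 'X - a, and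
    taking out these factors leaves a matrix whose value at a has the rows of
    pid_mx r on top and those of D(a) below. The hypothesis, that D(a) sends no
    nonzero vector of the kernel of M into the image of M, says exactly that
    this value is invertible, so the determinant vanishes to order n - r. *)
Lemma mup_det_transversal n (M : 'M[F]_n) (D : 'M[{poly F}]_n) (a : F) :
    (forall v x : 'cV_n, M *m v = 0 -> evalmx a D *m v = M *m x -> v = 0) ->
  let p := \det (map_mx polyC M + ('X - a%:P) *: D) in
  p != 0 /\ mup a p = (n - \rank M)%N.
Proof.
move=> Mtrans p; set r : nat := \rank M.
set t : {poly F} := 'X - a%:P in p *.
set L := col_ebase M; set U := row_ebase M.
have Lu : L \in unitmx by exact: col_ebase_unit.
have Uu : U \in unitmx by exact: row_ebase_unit.
have defM : L *m pid_mx r *m U = M by exact: mulmx_ebase.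
pose D' := map_mx polyC (invmx L) *m D *m map_mx polyC (invmx U).
(* S collects the row factors 'X - a and Q is the matrix that remains. *)
pose S : 'M[{poly F}]_n := diag_mx (\row_(i < n) if (i < r)%N then 1 else t).
pose Q : 'M[{poly F}]_n := \matrix_(i, j)
  if (i < r)%N then (i == j)%:R + t * D' i j else D' i j.
have SQ : S *m Q = pid_mx r + t *: D'.
  apply/matrixP=> i j; rewrite mul_diag_mx !mxE -val_eqE /=.
  by case: ifP => ir; rewrite ?mul1r ?andbT // andbF add0r.
have defD : D = map_mx polyC L *m D' *m map_mx polyC U.
  rewrite /D' !mulmxA -map_mxM mulmxV // map_mx1 mul1mx -mulmxA -map_mxM.
  by rewrite mulVmx // map_mx1 mulmx1.
clearbody D'.
have defp : p = (\det L * \det U)%:P * (t ^+ (n - r) * \det Q).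
  have -> : t ^+ (n - r) = \det S.
    rewrite det_diag; under eq_bigr do rewrite mxE.
    by rewrite prod_ord_geq ?rank_leq_row.
  rewrite -[\det S * _]det_mulmx SQ /p defD -defM !map_mxM map_pid_mx.
  rewrite -!mulmxA scalemxAr scalemxAl -mulmxDr.
  rewrite -mulmxDl !det_mulmx !det_map_mx.
  by rewrite polyCM mulrA mulrAC.
have Qa : (\det Q).[a] != 0.
  rewrite -det_evalmx -unitfE -unitmxE; apply: mulmx_inj_unitmx => x.
  have -> : evalmx a Q = pid_mx r + copid_mx r *m evalmx a D'.
    rewrite /copid_mx mulmxBl mul1mx; apply/matrixP=> i j.
    have -> : pid_mx r = diag_mx (\row_(k < n) (k < r)%N%:R) :> 'M[F]_n.
      by apply/matrixP=> k l; rewrite !mxE -val_eqE /= mulrb; case: (_ == _).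
    rewrite mul_diag_mx !mxE /horner_eval; case: (i < r)%N => /=.
      by case: (i == j); rewrite !hornerE /=; ring.
    by rewrite mul0rn mul0r add0r subr0.
  move=> Qx.
  have pidx : pid_mx r *m x = 0 :> 'cV_n.
    have: pid_mx r *m ((pid_mx r + copid_mx r *m evalmx a D') *m x) = 0
        :> 'cV_n.
      by rewrite Qx mulmx0.
    rewrite mulmxDl mulmxDr !mulmxA mul_pid_mx_copid ?rank_leq_row //.
    by rewrite !mul0mx addr0 pid_mx_id ?rank_leq_row.
  (* x is a null vector of Q(a): it lies in the kernel of pid_mx r, and D'(a)
     sends it into the image of pid_mx r. *)
  have D'x : evalmx a D' *m x = (pid_mx r : 'M_n) *m (evalmx a D' *m x).
    apply/eqP; rewrite -subr_eq0 -[X in X - _]mul1mx -mulmxBl mulmxA.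
    by move: Qx; rewrite mulmxDl pidx add0r => ->.
  have ev : evalmx a D = L *m evalmx a D' *m U.
    by rewrite [in LHS]defD !evalmxM !evalmx_polyC.
  have /(congr1 (mulmx U)) : invmx U *m x = 0.
    apply: (Mtrans _ (invmx U *m (evalmx a D' *m x))); rewrite -?defM ?ev.
      by rewrite -!mulmxA (mulKVmx Uu) pidx mulmx0.
    by rewrite -!mulmxA !(mulKVmx Uu) -D'x.
  by rewrite mulKVmx // mulmx0.
have LU_neq0 : \det L * \det U != 0.
  by rewrite mulf_neq0 // -unitfE -unitmxE.
have Q_neq0 : \det Q != 0 by apply: contraNneq Qa => ->; rewrite horner0.
split.
  by rewrite defp !mulf_neq0 ?polyC_eq0 ?expf_neq0 ?polyXsubC_eq0.
by rewrite defp mupMr ?rootC // mupMl // mup_XsubCX eqxx.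
Qed.

End Determinant.

(** * Calculus of two by two matrices *)

Section TwoByTwo.

Lemma mul_mx2 (T : nzRingType) (a b c d a' b' c' d' : T) :
  mx2 a b c d *m mx2 a' b' c' d' =
  mx2 (a * a' + b * c') (a * b' + b * d') (c * a' + d * c') (c * b' + d * d').
Proof.
by apply/matrixP=> i j; rewrite !mxE !big_ord_recl big_ord0 !mxE /= addr0;
   case: i => -[|[|//]] ?; case: j => -[|[|//]] ?.
Qed.

Lemma add_mx2 (T : nzRingType) (a b c d a' b' c' d' : T) :
  mx2 a b c d + mx2 a' b' c' d' = mx2 (a + a') (b + b') (c + c') (d + d').
Proof.
by apply/matrixP=> i j; rewrite !mxE; do 2!case: (_ == _).
Qed.

Lemma opp_mx2 (T : nzRingType) (a b c d : T) :
  - mx2 a b c d = mx2 (- a) (- b) (- c) (- d).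
Proof. by apply/matrixP=> i j; rewrite !mxE; do 2!case: (_ == _). Qed.

Lemma scale_mx2 (T : nzRingType) (k a b c d : T) :
  k *: mx2 a b c d = mx2 (k * a) (k * b) (k * c) (k * d).
Proof. by apply/matrixP=> i j; rewrite !mxE; do 2!case: (_ == _). Qed.

Lemma map_mx2 (T U : nzRingType) (h : T -> U) (a b c d : T) :
  map_mx h (mx2 a b c d) = mx2 (h a) (h b) (h c) (h d).
Proof. by apply/matrixP=> i j; rewrite !mxE; do 2!case: (_ == _). Qed.

Lemma tr_mx2 (T : nzRingType) (a b c d : T) : (mx2 a b c d)^T = mx2 a c b d.
Proof. by apply/matrixP=> i j; rewrite !mxE; do 2!case: (_ == _). Qed.

Lemma mx2_1 (T : nzRingType) : mx2 1 0 0 1 = 1%:M :> 'M[T]_2.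
Proof.
by apply/matrixP=> i j; rewrite !mxE;
   case: i => -[|[|//]] ?; case: j => -[|[|//]] ?.
Qed.

Lemma mulEE (T : nzRingType) : Emx T *m Emx T = - 1%:M.
Proof.
rewrite /Emx mul_mx2 -mx2_1 opp_mx2.
by rewrite !(mul0r, mulr0, mul1r, mulr1, add0r, addr0, oppr0).
Qed.

Definition col2 (T : nzRingType) (a b : T) : 'cV[T]_2 :=
  \col_(i < 2) if i == 0 then a else b.

Lemma mul_mx2_col2 (T : nzRingType) (a b c d x y : T) :
  mx2 a b c d *m col2 x y = col2 (a * x + b * y) (c * x + d * y).
Proof.
apply/matrixP=> i j; rewrite !mxE !big_ord_recl big_ord0 !mxE /= addr0.
by case: (_ == _).
Qed.

Lemma eq_col2 (T : nzRingType) (v : 'cV[T]_2) : v = col2 (v 0 0) (v 1 0).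
Proof.
apply/matrixP=> i j; rewrite !mxE (ord1 j).
by case: i => -[|[|//]] ?; congr (v _ _); apply: val_inj.
Qed.

Lemma eq_mx2 (T : nzRingType) (M : 'M[T]_2) :
  M = mx2 (M 0 0) (M 0 1) (M 1 0) (M 1 1).
Proof.
apply/matrixP=> i j; rewrite !mxE.
by case: i => -[|[|//]] ?; case: j => -[|[|//]] ?;
   congr (M _ _); apply: val_inj.
Qed.

Lemma col2_inj (T : nzRingType) (a b c d : T) :
  col2 a b = col2 c d -> a = c /\ b = d.
Proof.
by move=> e; split; [have := congr1 (fun v : 'cV_2 => v 0 0) e
                    |have := congr1 (fun v : 'cV_2 => v 1 0) e]; rewrite !mxE.
Qed.

End TwoByTwo.

Section ConjugateTranspose.
Variable C : numClosedFieldType.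

Lemma trCM m n p (X : 'M[C]_(m, n)) (Y : 'M_(n, p)) :
  (X *m Y)^t* = Y^t* *m X^t*.
Proof. by rewrite trmx_mul map_mxM. Qed.

End ConjugateTranspose.

(** * The fundamental matrix as a polynomial in the spectral parameter *)

Section Propagator.
Context {R : realType}.
Local Notation C := R[i].
Variables (N : nat) (f q w : nat -> C).

(** The step from (y_n, f_n Delta y_n) to the same pair at n + 1. The entries
    are polynomials in the spectral parameter, so that the order of a zero of
    the determinant of A + B Phi_N makes sense. *)
Definition step n : 'M[{poly C}]_2 :=
  let Q := (q n.+1)%:P - w n.+1 *: 'X in
  mx2 1 (f n)^-1%:P Q (1 + Q * (f n)^-1%:P).

Fixpoint propagator n : 'M[{poly C}]_2 :=
  if n is m.+1 then step m *m propagator m else 1%:M.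

Lemma evalmx_step z n :
  let Q := q n.+1 - z * w n.+1 in
  evalmx z (step n) = mx2 1 (f n)^-1 Q (1 + Q * (f n)^-1).
Proof.
by rewrite /evalmx map_mx2 /= /horner_eval !hornerE [z * _]mulrC.
Qed.

Lemma evalmx_propagator0 z : evalmx z (propagator 0) = 1%:M.
Proof. by rewrite /evalmx /= map_mx1. Qed.

Lemma evalmx_propagatorS z n :
  evalmx z (propagator n.+1) = evalmx z (step n) *m evalmx z (propagator n).
Proof. exact: evalmxM. Qed.

Lemma sol_state_propagator z a b n :
  let s := sol_state f q w z a b n in
  col2 s.1 s.2 = evalmx z (propagator n) *m col2 a b.
Proof.
elim: n => [|n IHn] /=; first by rewrite evalmx_propagator0 mul1mx.
rewrite evalmx_propagatorS -mulmxA -IHn evalmx_step /=.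
case: (sol_state _ _ _ _ _ _ n) => u v /=; rewrite mul_mx2_col2.
by congr col2; [rewrite mul1r mulrC | ring].
Qed.

Hypothesis f_neq0 : forall n, (n <= N)%N -> f n != 0.

Lemma state_sol z a b n : (n <= N)%N ->
  state f (sol f q w z a b) n = evalmx z (propagator n) *m col2 a b.
Proof.
by move=> nN; rewrite -sol_state_propagator /state (sol_fdiff _ _ f_neq0).
Qed.

(** The columns of Phi_n are the images of the two unit initial vectors. *)
Lemma Phi_propagator z n : (n <= N)%N ->
  Phi f q w n z = evalmx z (propagator n).
Proof.
move=> nN; have := state_sol z 1 0 nN; have := state_sol z 0 1 nN.
rewrite [evalmx _ _]eq_mx2 !mul_mx2_col2 !(mulr0, mulr1, addr0, add0r).
by move=> /col2_inj[<- <-] /col2_inj[<- <-].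
Qed.

Lemma sol_linear z a b n :
  sol f q w z a b n = phi f q w z n * a + psi f q w z n * b.
Proof.
have := sol_state_propagator z a b n; have := sol_state_propagator z 1 0 n.
have := sol_state_propagator z 0 1 n.
rewrite /phi /psi /sol /=; case: (sol_state _ _ _ _ 0 _ _) => u v.
case: (sol_state _ _ _ _ 1 _ _) => u' v'.
case: (sol_state _ _ _ _ a _ _) => u'' v'' /=.
have -> : col2 a b = a *: col2 1 0 + b *: col2 0 1.
  by apply/matrixP=> i j; rewrite !mxE; case: (_ == _); ring.
move=> e1 e2; rewrite mulmxDr -!scalemxAr -e1 -e2.
by move/(congr1 (fun v : 'cV_2 => v 0 0)); rewrite !mxE /= => ->; ring.
Qed.

End Propagator.

(** * Lagrange identity and positivity of the weight form *)

Section Lagrange.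
Context {R : realType}.
Local Notation C := R[i].
Variables (N : nat) (f q w : nat -> C).
Local Notation T z n := (evalmx z (propagator f q w n)).
Local Notation E := (Emx C).
Hypothesis f_real : forall n, (n <= N)%N -> f n \is Num.real /\ f n != 0.
Hypothesis q_real : forall n, (1 <= n <= N)%N -> q n \is Num.real.
Hypothesis w_pos : forall n, (1 <= n <= N)%N -> w n \is Num.real /\ 0 < w n.

Definition top_row z n : 'rV[C]_2 := row 0 (T z n).

(** The sum of w_k r_k(mu)^* r_k over k = 1, ..., n, where the row r_k maps
    initial data to the value y_k of the solution. It is evaluated at a fixed
    mu on the left and remains polynomial on the right. *)
Definition weight_form (mu : C) n : 'M[{poly C}]_2 :=
  \sum_(k < n) (w k.+1)%:P *:
     (map_mx polyC ((top_row mu k.+1)^t*) *m row 0 (propagator f q w k.+1)).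

Lemma evalmx_weight_form mu z n :
  evalmx z (weight_form mu n) =
  \sum_(k < n) w k.+1 *: ((top_row mu k.+1)^t* *m top_row z k.+1).
Proof.
rewrite /evalmx map_mx_sum; apply: eq_bigr => k _.
rewrite map_mxZ -/(evalmx _ _) evalmxM evalmx_polyC /evalmx map_row.
by rewrite /= /horner_eval hornerC.
Qed.

(** Because f, q and w are real, a step is symplectic except for the change of
    spectral parameter, which enters only through w_{n+1}. The rank one matrix
    is the product r^* r for the first row r = (1, 1 / f_n) of the step. *)
Lemma step_lagrange mu z n : (n < N)%N ->
  (evalmx mu (step f q w n))^t* *m E *m evalmx z (step f q w n) =
  E + ((mu^* - z) * w n.+1) *: mx2 1 (f n)^-1 (f n)^-1 ((f n)^-1 * (f n)^-1).
Proof.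
move=> nN; have [fR _] := f_real (ltnW nN).
have [wR _] := @w_pos n.+1 nN; have qR := @q_real n.+1 nN.
rewrite !evalmx_step tr_mx2 map_mx2 /Emx !mul_mx2 scale_mx2 add_mx2.
rewrite !(rmorphD, rmorphN, rmorphM, rmorph1, fmorphV) /=.
rewrite !(CrealP fR, CrealP wR, CrealP qR).
by congr mx2; ring.
Qed.

(** The form E is carried along from 0 to n by one step at a time; the defects
    of the steps add up to the weight form. *)
Lemma lagrange_identity mu z n : (n <= N)%N ->
  (T mu n)^t* *m E *m T z n =
  E + (mu^* - z) *: evalmx z (weight_form mu n).
Proof.
rewrite evalmx_weight_form; elim: n => [|n IHn] nN.
  rewrite big_ord0 scaler0 addr0 !evalmx_propagator0 trmx1 map_mx1 mul1mx.
  by rewrite mulmx1.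
rewrite big_ord_recr /= scalerDr addrA -IHn 1?ltnW //.
rewrite !evalmx_propagatorS trCM.
set Smu := evalmx mu (step f q w n); set Sz := evalmx z (step f q w n).
transitivity ((T mu n)^t* *m (Smu^t* *m E *m Sz) *m T z n).
  by rewrite !mulmxA.
rewrite step_lagrange // mulmxDr mulmxDl; congr (_ + _).
rewrite scalerA /top_row !evalmx_propagatorS !row_mul trCM -!mulmxA.
rewrite -scalemxAl -scalemxAr; congr (_ *: _); congr (_ *m _).
rewrite mulmxA; congr (_ *m _); rewrite !evalmx_step.
apply/matrixP=> i j; rewrite !mxE big_ord_recl big_ord0 !mxE /= addr0.
have [fR _] := f_real (ltnW nN).
case: (i == 0); case: (j == 0); rewrite ?rmorph1 ?mul1r ?mulr1 //.
- by rewrite fmorphV /= (CrealP fR).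
- by rewrite fmorphV /= (CrealP fR).
Qed.

Lemma weight_form_sum_sq z n (v : 'cV[C]_2) : (n <= N)%N ->
  v^t* *m evalmx z (weight_form z n) *m v =
  (\sum_(k < n) w k.+1 * `|(top_row z k.+1 *m v) 0 0| ^+ 2)%:M.
Proof.
move=> nN; rewrite evalmx_weight_form mulmx_sumr mulmx_suml raddf_sum.
apply: eq_bigr => k _; rewrite -scalemxAr -scalemxAl.
set r := top_row z k.+1.
have -> : v^t* *m (r^t* *m r) *m v = (r *m v)^t* *m (r *m v).
  by rewrite trCM !mulmxA.
move: (r *m v) => x; rewrite [in LHS](mx11_scalar x) tr_scalar_mx map_scalar_mx.
by rewrite mul_scalar_mx !scale_scalar_mx normCKC.
Qed.

(** A solution on which the weight form vanishes has y_1 = y_2 = 0, and the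
    recurrence run backwards from there gives zero initial data. Both y_1 and
    y_2 must occur in the sum, hence 2 <= N. *)
Lemma weight_form_definite z (v : 'cV[C]_2) : (2 <= N)%N ->
  v^t* *m evalmx z (weight_form z N) *m v = 0 -> v = 0.
Proof.
move=> N2; rewrite weight_form_sum_sq // => /(congr1 (fun M : 'M_1 => M 0 0)).
rewrite !mxE eqxx mulr1n => /eqP; rewrite psumr_eq0; last first.
  by move=> k _; rewrite mulr_ge0 ?exprn_ge0 // ltW // (w_pos _).2 /=.
move=> /allP zero.
have top0 k : (k < N)%N -> (top_row z k.+1 *m v) 0 0 = 0.
  move=> kN; have := zero (Ordinal kN) (mem_index_enum _).
  rewrite /= mulf_eq0 (gt_eqF (w_pos _).2) //= expf_eq0 /= normr_eq0.
  by move/eqP.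
have := top0 0%N (ltnW N2); have := top0 1%N N2.
rewrite /top_row -!row_mul !evalmx_propagatorS evalmx_propagator0 mulmx1.
rewrite !evalmx_step [v]eq_col2 -mulmxA !mul_mx2_col2 !mxE /=.
set x := v 0 0; set y := v 1 0; rewrite !mul1r => y2_0 y1_0.
have y0 : y = 0.
  apply: (mulfI (invr_neq0 (f_real (ltnW N2)).2)); rewrite mulr0 -[RHS]y2_0.
  have -> : x = - ((f 0)^-1 * y) by apply/eqP; rewrite -addr_eq0 y1_0.
  by ring.
by move: y1_0; rewrite y0 mulr0 addr0 => ->;
   apply/matrixP=> i j; rewrite !mxE if_same.
Qed.

End Lagrange.

(** * Self-adjoint boundary conditions *)

Section Boundary.
Variable C : numClosedFieldType.
Local Notation E := (Emx C).

(** Self-adjointness says that the rows of (A E, - B E) are orthogonal to those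
    of (A, B). Both row spaces have dimension 2 in dimension 4, so the first is
    the whole orthogonal complement of the second, and therefore contains the
    conjugate transpose of every (x, z) satisfying A x + B z = 0. *)
Lemma boundary_null_vector (A B : 'M[C]_2) (x z : 'cV[C]_2) :
    \rank (row_mx A B) = 2%N -> A *m E *m A^t* = B *m E *m B^t* ->
    A *m x + B *m z = 0 ->
  exists u : 'rV[C]_2, u *m A = x^t* *m E /\ u *m B = - (z^t* *m E).
Proof.
move=> rkAB sa Axz; set G := row_mx A B in rkAB *.
pose W := row_mx (A *m E) (- (B *m E)).
have defG : G = W *m block_mx (- E) 0 0 E.
  rewrite /W mul_row_block !mulmx0 addr0 add0r mulmxN mulNmx -!mulmxA mulEE.
  by rewrite !mulmxN !mulmx1 !opprK.
have WG : (W <= kermx (G^t*))%MS.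
  apply/sub_kermxP; rewrite tr_row_mx map_col_mx mul_row_col mulNmx.
  by rewrite sa subrr.
have XG : ((col_mx x z)^t* <= kermx (G^t*))%MS.
  by apply/sub_kermxP; rewrite -trCM mul_row_col Axz trmx0 map_mx0.
have /submxP[u] : ((col_mx x z)^t* <= W)%MS.
  apply: submx_trans XG _; rewrite -(geq_leqif (mxrank_leqif_sup WG)).
  rewrite mxrank_ker mxrank_map mxrank_tr rkAB -[X in (X <= _)%N]rkAB defG.
  exact: mxrankM_maxl.
rewrite tr_col_mx map_row_mx mul_mx_row => /eq_row_mx[-> ->].
exists (- u); split; rewrite !(mulmxN, mulNmx) -!mulmxA mulEE.
  by rewrite !(mulmxN, mulmx1).
by rewrite !(mulmxN, mulmx1) !opprK.
Qed.

End Boundary.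

(** * Dimension of the kernel of a matrix *)

Section Dimension.
Variable F : fieldType.

Lemma dim_limg_mulmx m n (W : 'M[F]_(m, n)) :
  (forall x : 'cV_n, W *m x = 0 -> x = 0) ->
  \dim (limg (linfun (mulmx W : 'cV_n -> 'cV_m))) = n.
Proof.
move=> Winj; rewrite limg_dim_eq ?dimvf ?/dim /= ?muln1 //.
apply/eqP; rewrite capfv -subv0; apply/subvP => x.
by rewrite memv_ker lfunE /= memv0 => /eqP /Winj ->.
Qed.

Lemma mulmx_kernel_param n (M : 'M[F]_n) :
  let K := (row_base (kermx M^T))^T in
  (forall v : 'cV_n, M *m v = 0 <-> exists x, v = K *m x) /\
  (forall x : 'cV_(\rank (kermx M^T)), K *m x = 0 -> x = 0).
Proof.
split=> [v|x].
  split=> [Mv | [x ->]].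
    have /submxP[x vx] : (v^T <= row_base (kermx M^T))%MS.
      by rewrite eq_row_base; apply/sub_kermxP; rewrite -trmx_mul Mv trmx0.
    by exists x^T; rewrite -trmx_mul -vx trmxK.
  apply: trmx_inj; rewrite trmx0 trmx_mul trmx_mul trmxK -mulmxA.
  have /sub_kermxP -> : (row_base (kermx M^T) <= kermx M^T)%MS.
    by rewrite eq_row_base.
  by rewrite mulmx0.
move/(congr1 trmx); rewrite trmx_mul trmxK trmx0 => Kx.
apply: trmx_inj; rewrite trmx0.
apply: (row_free_inj (row_base_free (kermx M^T))).
by rewrite mul0mx.
Qed.

End Dimension.

(** * Eigenvalues of a self-adjoint problem *)

Section SelfAdjointProblem.
Context {R : realType}.
Local Notation C := R[i].
Variables (N : nat) (f q w : nat -> C) (A B : 'M[C]_2).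
Hypothesis N_ge2 : (2 <= N)%N.
Hypothesis rankAB : \rank (row_mx A B) = 2%N.
Hypothesis sa : self_adjoint N f q w A B.

Local Notation T z := (evalmx z (propagator f q w N)).
Local Notation P mu z := (evalmx z (weight_form f q w mu N)).
Local Notation E := (Emx C).

Let f_real n : (n <= N)%N -> f n \is Num.real /\ f n != 0.
Proof. by case: sa => h _ _ _; exact: h. Qed.
Let q_real n : (1 <= n <= N)%N -> q n \is Num.real.
Proof. by case: sa => _ h _ _; exact: h. Qed.
Let w_pos n : (1 <= n <= N)%N -> w n \is Num.real /\ 0 < w n.
Proof. by case: sa => _ _ h _; exact: h. Qed.
Let f_neq0 n : (n <= N)%N -> f n != 0.
Proof. by case/f_real. Qed.

Let lagrangeN mu z : (T mu)^t* *m E *m T z = E + (mu^* - z) *: P mu z.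
Proof. exact: (lagrange_identity f_real q_real w_pos). Qed.

Definition char_mx z : 'M[C]_2 := A + B *m T z.

(** The row u provided by the boundary condition turns a null vector of the
    characteristic matrix M on the right into one on the left, up to the defect
    of the Lagrange identity, which is zero when z is real. *)
Lemma char_mx_null z (v : 'cV_2) : char_mx z *m v = 0 ->
  exists u : 'rV[C]_2, u *m B = - (v^t* *m (T z)^t* *m E) /\
    u *m char_mx z = (z - z^*) *: (v^t* *m P z z).
Proof.
rewrite mulmxDl -mulmxA; case: sa => _ _ _ saAB.
case/(boundary_null_vector rankAB saAB) => u [uA]; rewrite trCM => uB.
exists u; split=> //.
rewrite /char_mx mulmxDr uA mulmxA uB mulNmx.
have -> : v^t* *m (T z)^t* *m E *m T z = v^t* *m ((T z)^t* *m E *m T z).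
  by rewrite !mulmxA.
rewrite lagrangeN mulmxDr opprD addrA subrr add0r.
by rewrite -scalemxAr -scaleNr opprB.
Qed.

(** Multiply u M = (z - z^* ) v^* P on the right by v. The left side vanishes,
    and v^* P v does not. *)
Lemma eigenvalue_real z (v : 'cV_2) :
  char_mx z *m v = 0 -> v != 0 -> z^* = z.
Proof.
move=> Mv v_neq0; have [u [_ uM]] := char_mx_null Mv.
have : (z - z^*) *: (v^t* *m P z z *m v) = 0.
  by rewrite scalemxAl -uM -mulmxA Mv mulmx0.
move/eqP; rewrite scaler_eq0 subr_eq0 => /orP[/eqP //|/eqP].
move/(weight_form_definite f_real w_pos N_ge2) => v0.
by rewrite v0 eqxx in v_neq0.
Qed.

Lemma propagator_symplectic l : l^* = l -> (T l)^t* *m E *m T l = E.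
Proof. by move=> lR; rewrite lagrangeN lR subrr scale0r addr0. Qed.

(** The difference quotient at l of the characteristic matrix. It is polynomial
    because the Lagrange identity already displays the factor z - l. *)
Definition slope_mx l : 'M[{poly C}]_2 :=
  map_mx polyC (B *m T l *m E) *m weight_form f q w l N.

(** At a real l the Lagrange identity determines T z, since the symplectic
    matrix T l has the explicit inverse - E (T l)^* E. *)
Lemma propagator_expansion l z : l^* = l ->
  T z = T l + (z - l) *: (T l *m E *m P l z).
Proof.
move=> lR; have TT := propagator_symplectic lR.
have inv_T : T l *m - (E *m (T l)^t* *m E) = 1%:M.
  apply: mulmx1C; rewrite mulNmx.
  have -> : E *m (T l)^t* *m E *m T l = E *m ((T l)^t* *m E *m T l).
    by rewrite !mulmxA.
  by rewrite TT mulEE opprK.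
have -> : T z = - (T l *m E *m ((T l)^t* *m E *m T z)).
  by rewrite -[LHS]mul1mx -inv_T mulmxN mulNmx !mulmxA.
rewrite lagrangeN lR mulmxDr -mulmxA mulEE mulmxN mulmx1 opprD opprK.
by rewrite -scalemxAr -scaleNr opprB.
Qed.

Lemma char_mx_expansion l z : l^* = l ->
  char_mx z = char_mx l + (z - l) *: evalmx z (slope_mx l).
Proof.
move=> lR; rewrite /char_mx {1}(propagator_expansion z lR) mulmxDr addrA.
rewrite -scalemxAr /slope_mx evalmxM evalmx_polyC.
by rewrite !mulmxA.
Qed.

(** Apply the left null vector u of the characteristic matrix M at l to the
    equation D v = M x. The right side becomes zero and the left side v^* P v,
    so v = 0 by positivity. This is where self-adjointness excludes
    Jordan chains. *)
Lemma char_mx_transversal l (v x : 'cV_2) : l^* = l ->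
  char_mx l *m v = 0 -> evalmx l (slope_mx l) *m v = char_mx l *m x -> v = 0.
Proof.
move=> lR Mv Dv; have [u [uB uM]] := char_mx_null Mv.
have := congr1 (mulmx u) Dv.
rewrite /= (mulmxA u (char_mx l)) uM lR subrr scale0r mul0mx.
rewrite /slope_mx evalmxM evalmx_polyC !mulmxA uB.
move=> vPv; apply: (weight_form_definite f_real w_pos N_ge2).
rewrite -[RHS]vPv !mulNmx.
have -> : v^t* *m (T l)^t* *m E *m T l = v^t* *m ((T l)^t* *m E *m T l).
  by rewrite !mulmxA.
rewrite (propagator_symplectic lR) -(mulmxA _ E E) mulEE.
by rewrite mulmxN mulmx1 !mulNmx opprK.
Qed.

Lemma Gamma_char_mx z : Gamma N f q w A B z = \det (char_mx z).
Proof. by rewrite /Gamma (Phi_propagator q w f_neq0). Qed.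

Lemma analytic_multiplicity_corank l : l^* = l ->
  analytic_multiplicity N f q w A B l (2 - \rank (char_mx l)).
Proof.
move=> lR.
have [p_neq0 mup_p] :=
  mup_det_transversal (fun v x : 'cV_2 => @char_mx_transversal l v x lR).
exists (\det (map_mx polyC (char_mx l) + ('X - l%:P) *: slope_mx l)).
split=> // z; rewrite Gamma_char_mx (char_mx_expansion z lR) -det_evalmx.
congr (\det _); apply/matrixP=> i j.
by rewrite !mxE /horner_eval !hornerE.
Qed.

Definition solution_mx l : 'M[C]_(N.+2, 2) :=
  \matrix_(i, j) if j == 0 then phi f q w l i else psi f q w l i.

Lemma solution_mxE l (v : 'cV_2) i :
  (solution_mx l *m v) i 0 = sol f q w l (v 0 0) (v 1 0) i.
Proof.
rewrite sol_linear mxE !big_ord_recl big_ord0 !mxE addr0.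
by congr (_ + _ * v _ _); apply: val_inj.
Qed.

Lemma term_solution_mx l (v : 'cV_2) n : (n <= N.+1)%N ->
  term (solution_mx l *m v) n = sol f q w l (v 0 0) (v 1 0) n.
Proof. by move=> nN; rewrite /term solution_mxE inordK. Qed.

Lemma solution_mx_inj l (v : 'cV_2) : solution_mx l *m v = 0 -> v = 0.
Proof.
move=> Sv0; have term0 n : (n <= N.+1)%N -> sol f q w l (v 0 0) (v 1 0) n = 0.
  by move=> nN; rewrite -term_solution_mx // Sv0 /term mxE.
have [e0 e1] := sol_init q w f_neq0 l (v 0 0) (v 1 0).
have v0 : v 0 0 = 0 by rewrite -[LHS]e0 term0.
have v1 : v 1 0 = 0 by rewrite -[LHS]e1 /fwd_diff !term0 // subrr mulr0.
rewrite [v]eq_col2 v0 v1.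
by apply/matrixP=> i j; rewrite !mxE if_same.
Qed.

Lemma eq_sl_equation l y y' : (forall n, (n <= N.+1)%N -> y n = y' n) ->
  sl_equation N f q w l y -> sl_equation N f q w l y'.
Proof.
move=> eqy yl [//|n] nN; have := yl n.+1 nN; rewrite /bwd_diff /fwd_diff /=.
by rewrite !eqy // ?leqW // ltnW // ltnW.
Qed.

Lemma eq_state y y' n : (forall n, (n <= N.+1)%N -> y n = y' n) ->
  (n <= N)%N -> state f y n = state f y' n.
Proof. by move=> eqy nN; rewrite /state /fwd_diff !eqy // leqW. Qed.

Lemma boundary_condition_sol l a b :
  boundary_condition N f A B (sol f q w l a b) <-> char_mx l *m col2 a b = 0.
Proof.
rewrite /boundary_condition !(state_sol q w f_neq0) // evalmx_propagator0.
by rewrite mul1mx mulmxA -mulmxDl.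
Qed.

(** This turns the geometric multiplicity into the dimension of the kernel of
    char_mx l: a solution is determined by its initial data v, and the boundary
    condition becomes A v + B T(l) v = 0. *)
Lemma solution_space l y :
  sl_equation N f q w l (term y) /\ boundary_condition N f A B (term y) <->
  exists2 v : 'cV_2, char_mx l *m v = 0 & y = solution_mx l *m v.
Proof.
split=> [[yl yAB] | [v Mv ->]].
  pose v := state f (term y) 0.
  have ysol n : (n <= N.+1)%N -> term y n = sol f q w l (v 0 0) (v 1 0) n.
    by apply: (sol_unique f_neq0 yl); rewrite !mxE.
  exists v.
    rewrite [v]eq_col2; apply/boundary_condition_sol.
    by move: yAB; rewrite /boundary_condition !(eq_state ysol).
  apply/matrixP=> i j; rewrite (ord1 j) solution_mxE -ysol -1?ltnS //.
  by rewrite /term inord_val.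
have ysol n := @term_solution_mx l v n.
split.
  apply: (@eq_sl_equation l (sol f q w l (v 0 0) (v 1 0))).
    by move=> n nN; rewrite ysol.
  exact: sol_equation.
rewrite /boundary_condition !(eq_state ysol) //.
by apply/boundary_condition_sol; rewrite -eq_col2.
Qed.

Lemma geometric_multiplicity_corank l :
  geometric_multiplicity N f q w A B l (2 - \rank (char_mx l)).
Proof.
set M := char_mx l; have [kerM Kinj] := mulmx_kernel_param M.
set K := (row_base (kermx M^T))^T in kerM Kinj.
exists (limg (linfun (mulmx (solution_mx l *m K) :
  'cV_(\rank (kermx M^T)) -> 'cV_N.+2))); last first.
  rewrite dim_limg_mulmx ?mxrank_ker ?mxrank_tr // => x.
  by rewrite -mulmxA => /solution_mx_inj /Kinj.
split=> [y [_ yl yAB] | V eigV].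
  have [v /kerM[x ->] ->] := (solution_space l y).1 (conj yl yAB).
  by apply/memv_imgP; exists x; rewrite ?memvf // lfunE /= mulmxA.
apply/subvP=> y /memv_imgP[x _ ->]; rewrite lfunE /= -mulmxA.
set z := _ *m _; have [-> | z_neq0] := eqVneq z 0; first exact: mem0v.
apply: eigV; have [|zl zAB] := (solution_space l z).2; last by split.
by exists (K *m x) => //; apply/kerM; exists x.
Qed.

End SelfAdjointProblem.

Theorem theorem3p3 (R : realType) (N : nat) (f q w : nat -> R[i])
    (A B : 'M[R[i]]_2) :
  (2 <= N)%N ->
  \rank (row_mx A B) = 2%N ->
  self_adjoint N f q w A B ->
  forall lam : R[i], sl_eigenvalue N f q w A B lam ->
    exists2 k : nat, analytic_multiplicity N f q w A B lam k
                   & geometric_multiplicity N f q w A B lam k.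
Proof.
move=> N2 rkAB sa l [y [y_neq0 yl yAB]].
have [v Mv yv] := (solution_space sa l y).1 (conj yl yAB).
have v_neq0 : v != 0 by apply: contraNneq y_neq0 => v0; rewrite yv v0 mulmx0.
exists (2 - \rank (char_mx N f q w A B l))%N.
  apply: analytic_multiplicity_corank => //.
  exact: (eigenvalue_real N2 rkAB sa Mv v_neq0).
exact: geometric_multiplicity_corank.
Qed.
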